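(* There exist a finite-horizon MDP $M^\star$ with stochastic transitions and a data-collection policy $\pi_{\mathcal{D}}$ such that: (1) there is a model $M \neq M^\star$ whose expected multi-step reward-prediction loss (i.e., the loss in the limit of infinitely many data trajectories) is strictly smaller than that of the true model $M^\star$; and (2) this model $M$ gives a wrong evaluation to some policy $\pi$, i.e., $J_M(\pi) \neq J_{M^\star}(\pi)$.
   Context: A finite-horizon MDP with horizon $H$ has a state space $\mathcal{S}$, an action space $\mathcal{A}$, a fixed initial state $s_1$, transition kernel $P^\star:\mathcal{S}\times\mathcal{A}\to\Delta(\mathcal{S})$ and reward function $R^\star:\mathcal{S}\times\mathcal{A}\to[0,R_{\max}]$. For a model $M=(P,R)$ (a transition kernel and reward function on the same $\mathcal{S},\mathcal{A}$) and a policy $\pi$, $J_M(\pi)=\mathbb{E}_{M,\pi}[\sum_{h=1}^H r_h]$ denotes the expected return of $\pi$ when trajectories are generated by $M$; the true model is $M^\star=(P^\star,R^\star)$. Data consists of i.i.d. trajectories $(s_1,a_1,r_1,\ldots,s_H,a_H,r_H)$ generated by running a behavior policy $\pi_{\mathcal{D}}$ in $M^\star$, with $r_h=R^\star(s_h,a_h)$. The multi-step reward-prediction loss of a model $M=(P,R)$ on one trajectory is defined as follows: for each $h\in\{1,\ldots,H\}$, set $\hat s_h=s_h$ and for $h'=h,\ldots,H$ let $\hat r_{h'}=R(\hat s_{h'},a_{h'})$ and sample $\hat s_{h'+1}\sim P(\cdot\mid \hat s_{h'},a_{h'})$ (reusing the data actions $a_{h'}$); the loss is $\sum_{h=1}^H\sum_{h'=h}^H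 (r_{h'}-\hat r_{h'})^2$. The empirical loss averages this over data trajectories; the expected loss takes expectation over the data trajectory (drawn from $\pi_{\mathcal{D}}$ in $M^\star$) and over the model's sampling. *)

(* Defs.v *)
From HB Require Import structures.
From mathcomp Require Import all_boot all_order all_algebra.
From mathcomp Require Import reals.
Set Implicit Arguments. Unset Strict Implicit. Unset Printing Implicit Defensive.
Import Order.TTheory GRing.Theory Num.Theory.
Local Open Scope ring_scope.

Section MDPDefs.
Variable R : realType.
Variables S A : finType.

Definition is_dist (T : finType) (p : {ffun T -> R}) : Prop :=
  (forall x, 0 <= p x) /\ \sum_x p x = 1.

Definition kernel := S -> A -> {ffun S -> R}.
Definition valid_kernel (P : kernel) : Prop := forall s a, is_dist (P s a).

Definition stochastic (P : kernel) : Prop :=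
  exists s a s', 0 < P s a s' < 1.

(* (possibly time-dependent, stochastic) Markov policies; time index 0
   corresponds to step h = 1 of the paper *)
Definition policy := nat -> S -> {ffun A -> R}.
Definition valid_policy (pi : policy) : Prop := forall h s, is_dist (pi h s).

Record model := Model { trans : kernel; rew : S -> A -> R }.

Fixpoint Vrem (M : model) (pi : policy) (k h : nat) (s : S) : R :=
  match k with
  | 0 => 0
  | k'.+1 => \sum_a pi h s a *
              (rew M s a + \sum_s' trans M s a s' * Vrem M pi k' h.+1 s')
  end.

Definition J (M : model) (pi : policy) (H : nat) (s1 : S) : R :=
  Vrem M pi H 0 s1.

Fixpoint traj_prob_from (P : kernel) (pi : policy) (h : nat) (prev : S * A)
    (tau : seq (S * A)) : R :=
  match tau with
  | [::] => 1
  | (s, a) :: t => P prev.1 prev.2 s * pi h s a * traj_prob_from P pi h.+1 (s, a) t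
  end.

Definition traj_prob (P : kernel) (pi : policy) (s1 : S) (tau : seq (S * A)) : R :=
  match tau with
  | [::] => 1
  | (s, a) :: t => (s == s1)%:R * pi 0 s a * traj_prob_from P pi 1 (s, a) t
  end.

(* Expectation, over the model's sampling  s^_{h'+1} ~ P(.|s^_{h'},a_{h'}),
   of  sum_{h'} (r_{h'} - R(s^_{h'}, a_{h'}))^2  where the data suffix
   suf = [(s_{h'},a_{h'}); ...] supplies the actions and the data rewards
   r_{h'} = Rstar(s_{h'},a_{h'}), and shat is the current model state. *)
Fixpoint rollout_sqerr (Rstar : S -> A -> R) (M : model) (shat : S)
    (suf : seq (S * A)) : R :=
  match suf with
  | [::] => 0
  | (s, a) :: t => (Rstar s a - rew M shat a) ^+ 2
                   + \sum_s' trans M shat a s' * rollout_sqerr Rstar M s' t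
  end.

(* rollout started at s^_h = s_h for the suffix starting at step h *)
Definition loss_from (Rstar : S -> A -> R) (M : model) (suf : seq (S * A)) : R :=
  match suf with
  | [::] => 0
  | (s, _) :: _ => rollout_sqerr Rstar M s suf
  end.

(* multi-step reward-prediction loss of M on a trajectory, in expectation
   over the model's sampling: sum_{h=1}^H sum_{h'=h}^H (r_{h'} - r^_{h'})^2 *)
Definition traj_exp_loss (Rstar : S -> A -> R) (M : model) (tau : seq (S * A)) : R :=
  \sum_(h < size tau) loss_from Rstar M (drop h tau).

Definition exp_loss (Pstar : kernel) (Rstar : S -> A -> R) (piD : policy)
    (s1 : S) (H : nat) (M : model) : R :=
  \sum_(tau : H.-tuple (S * A))
     traj_prob Pstar piD s1 tau * traj_exp_loss Rstar M tau.

End MDPDefs.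

(* Main.v *)
Require Import Defs.
From HB Require Import structures.
From mathcomp Require Import all_boot all_order all_algebra.
From mathcomp Require Import reals.
From mathcomp Require Import lra.
Import Order.TTheory GRing.Theory Num.Theory.
Local Open Scope ring_scope.

(* In the true MDP a fair coin moves every state to state 0 or 1, and only
   state 1 pays a reward.  Rolling the true model out along a data trajectory
   samples its next state independently of the data, so the squared error of
   the predicted second reward has expectation twice the variance, 1/2.  A
   model that instead jumps deterministically to the unreachable state 2,
   paying 2/5 there, only incurs the variance plus the squared bias,
   1/4 + 1/100 = 13/50.  The bias is what makes it misjudge the return of the
   (only) policy: 2/5 instead of 1/2. *)

Lemma sum_tuple2 (V : nmodType) (T : finType) (F : 2.-tuple T -> V) :
  \sum_(t : 2.-tuple T) F t = \sum_x \sum_y F [tuple x; y].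
Proof.
rewrite pair_big (reindex (fun p : T * T => [tuple p.1; p.2])) //=.
exists (fun t : 2.-tuple T => (thead t, tnth t 1)) => [[x y] _ //|t _].
apply: eq_from_tnth => i; case: t => [[|x [|y []]] //] sz.
by case: i => [[|[|]]].
Qed.

Section HorizonTwo.
Variables (R : realType) (S A : finType).
Implicit Types (P : kernel R S A) (M : model R S A) (pi : policy R S A).

Lemma traj_exp_loss_size2 (Rstar : S -> A -> R) M s a s' a' :
  traj_exp_loss Rstar M [:: (s, a); (s', a')] =
    (Rstar s a - rew M s a) ^+ 2
    + \sum_s'' trans M s a s'' * (Rstar s' a' - rew M s'' a') ^+ 2
    + (Rstar s' a' - rew M s' a') ^+ 2.
Proof.
rewrite /traj_exp_loss /= !big_ord_recl big_ord0 /= -mulr_suml mulr0 !addr0.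
by congr (_ + _ + _); apply: eq_bigr => s'' _; rewrite -mulr_suml mulr0 addr0.
Qed.

Lemma exp_loss_horizon2 P (Rstar : S -> A -> R) pi s1 M :
  exp_loss P Rstar pi s1 2 M =
    \sum_a \sum_s' \sum_a' pi 0 s1 a * P s1 a s' * pi 1 s' a' *
      traj_exp_loss Rstar M [:: (s1, a); (s', a')].
Proof.
transitivity (\sum_s \sum_a \sum_s' \sum_a'
    traj_prob P pi s1 [:: (s, a); (s', a')] * traj_exp_loss Rstar M [:: (s, a); (s', a')]).
  rewrite /exp_loss sum_tuple2 [RHS]pair_bigA; apply: eq_bigr => -[s a] _.
  by rewrite [RHS]pair_bigA; apply: eq_bigr => -[].
rewrite (bigD1 s1) //= [X in _ + X]big1 ?addr0 => [|s ne]; last first.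
  by do 3!(apply: big1 => ? _); rewrite (negbTE ne) !mul0r.
by do 3!(apply: eq_bigr => ? _); rewrite eqxx mul1r mulr1 !mulrA.
Qed.

Lemma J_horizon2 M pi s :
  J M pi 2 s = \sum_a pi 0 s a *
    (rew M s a + \sum_s' trans M s a s' * \sum_a' pi 1 s' a' * rew M s' a').
Proof.
rewrite /J /=; apply: eq_bigr => a _; congr (_ * (_ + _)).
apply: eq_bigr => s' _; congr (_ * _); apply: eq_bigr => a' _.
by rewrite -mulr_suml mulr0 addr0.
Qed.

End HorizonTwo.

Lemma sum_ord3 (V : nmodType) (F : 'I_3 -> V) :
  \sum_i F i = F (inord 0) + F (inord 1) + F (inord 2).
Proof.
rewrite !big_ord_recl big_ord0 addr0 addrA.
by congr (F _ + F _ + F _); apply/val_inj; rewrite /= inordK.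
Qed.

Section MeanRewardModel.
Variable R : realType.

Definition coin_kernel : kernel R 'I_3 'I_1 :=
  fun _ _ => [ffun s => if val s == 2%N then 0 else 2^-1].
Definition coin_reward : 'I_3 -> 'I_1 -> R := fun s _ => (val s == 1%N)%:R.

Definition mean_kernel : kernel R 'I_3 'I_1 :=
  fun _ _ => [ffun s => (val s == 2%N)%:R].
Definition mean_reward : 'I_3 -> 'I_1 -> R :=
  fun s a => if val s == 2%N then 2 / 5 else coin_reward s a.

Definition only_action : policy R 'I_3 'I_1 := fun _ _ => [ffun => 1].

Lemma coin_kernel_valid : valid_kernel coin_kernel.
Proof.
move=> s a; split=> [s'|]; first by rewrite ffunE; case: ifP => _; lra.
by rewrite sum_ord3 !ffunE /= !inordK //=; lra.
Qed.

Lemma coin_kernel_stochastic : stochastic coin_kernel.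
Proof. by exists ord0, ord0, ord0; rewrite ffunE /=; apply/andP; split; lra. Qed.

Lemma mean_kernel_valid : valid_kernel mean_kernel.
Proof.
move=> s a; split=> [s'|]; first by rewrite ffunE ler0n.
by rewrite sum_ord3 !ffunE /= !inordK //= !add0r.
Qed.

Lemma only_action_valid : valid_policy only_action.
Proof. by move=> h s; split=> [a|]; rewrite ?big_ord1 ffunE. Qed.

Lemma coin_reward_bounded s a : 0 <= coin_reward s a <= 1.
Proof. by rewrite /coin_reward; case: (_ == _); rewrite /= lexx ler01. Qed.

Lemma mean_reward_bounded s a : 0 <= mean_reward s a <= 1.
Proof.
rewrite /mean_reward; case: ifP => _; last exact: coin_reward_bounded.
by apply/andP; split; lra.
Qed.

Let true_model := Model coin_kernel coin_reward.
Let mean_model := Model mean_kernel mean_reward.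

Ltac evaluate :=
  rewrite ?exp_loss_horizon2 ?J_horizon2;
  rewrite !(big_ord1, sum_ord3, traj_exp_loss_size2, ffunE) /=;
  rewrite /mean_reward /coin_reward /= !inordK //=; lra.

Lemma exp_loss_true_model :
  exp_loss coin_kernel coin_reward only_action ord0 2 true_model = 1 / 2.
Proof. evaluate. Qed.

Lemma exp_loss_mean_model :
  exp_loss coin_kernel coin_reward only_action ord0 2 mean_model = 13 / 50.
Proof. evaluate. Qed.

Lemma J_true_model : J true_model only_action 2 ord0 = 1 / 2.
Proof. evaluate. Qed.

Lemma J_mean_model : J mean_model only_action 2 ord0 = 2 / 5.
Proof. evaluate. Qed.

End MeanRewardModel.

Theorem proposition1 (R : realType) :
  exists (S A : finType) (H : nat) (s1 : S) (Pstar : kernel R S A)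
         (Rstar : S -> A -> R) (Rmax : R) (piD : policy R S A),
    [/\ valid_kernel Pstar, stochastic Pstar,
        (forall s a, 0 <= Rstar s a <= Rmax), valid_policy piD &
    exists (M : model R S A) (pi : policy R S A),
      valid_kernel (trans M) /\
      (forall s a, 0 <= rew M s a <= Rmax) /\
      (exists s a, trans M s a != Pstar s a \/ rew M s a != Rstar s a) /\
      exp_loss Pstar Rstar piD s1 H M
        < exp_loss Pstar Rstar piD s1 H (Model Pstar Rstar) /\
      valid_policy pi /\
      J M pi H s1 != J (Model Pstar Rstar) pi H s1].
Proof.
exists 'I_3, 'I_1, 2%N, ord0, (@coin_kernel R), (@coin_reward R), 1, (@only_action R).
split; [exact: coin_kernel_valid | exact: coin_kernel_stochastic |
        exact: coin_reward_bounded | exact: only_action_valid |].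
exists (Model (@mean_kernel R) (@mean_reward R)), (@only_action R).
split; first exact: mean_kernel_valid.
split; first exact: mean_reward_bounded.
split.
  exists ord_max, ord0; right.
  by rewrite /mean_reward /coin_reward /=; apply/eqP; lra.
split; first by rewrite exp_loss_mean_model exp_loss_true_model; lra.
split; first exact: only_action_valid.
by rewrite J_mean_model J_true_model; apply/eqP; lra.
Qed.
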